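(* The numerical semigroups $S$ such that every extension of $S$ is an arithmetic extension of $S$ are exactly the following six: $\mathbb{N}$, $\langle 2,3\rangle$, $\langle 3,4,5\rangle$, $\langle 2,5\rangle$, $\langle 3,5,7\rangle$ and $\langle 4,5,7\rangle$.
   Context: $\mathbb{N}$ is the set of non-negative integers. A numerical semigroup is a subset $S\subseteq\mathbb{N}$ containing $0$, closed under addition, with $\mathbb{N}\setminus S$ finite. For a non-empty $A\subseteq\mathbb{N}$, $\langle A\rangle$ denotes the submonoid of $(\mathbb{N},+)$ generated by $A$, and $\langle a_1,\dots,a_k\rangle=\langle\{a_1,\dots,a_k\}\rangle$. Let $S,T$ be numerical semigroups. $T$ is an extension of $S$ if $S\subseteq T$. $T$ is an arithmetic extension of $S$ if there exist positive integers $d_1,\dots,d_n$ such that $T=\{x\in\mathbb{N}\mid d_i x\in S,\ i=1,\dots,n\}$. *)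

(* Defs.v *)
From mathcomp Require Import all_boot.
From mathcomp Require Import boolp classical_sets functions cardinality.

Set Implicit Arguments.
Unset Strict Implicit.
Unset Printing Implicit Defensive.

Local Open Scope classical_set_scope.

Definition submonoid (M : set nat) : Prop :=
  M 0 /\ (forall x y, M x -> M y -> M (x + y)).

Definition numerical_semigroup (S : set nat) : Prop :=
  submonoid S /\ finite_set (~` S).

Definition generated (A : set nat) : set nat := smallest submonoid A.

Definition extension (S T : set nat) : Prop := S `<=` T.

(* The family d is nonempty. The inclusion S `<=` T is not imposed: it follows
   from the displayed equality when S is a submonoid. *)
Definition arithmetic_extension (S T : set nat) : Prop :=
  exists (n : nat) (d : 'I_n -> nat),
    [/\ 0 < n,
        (forall i, 0 < d i) &
        T = [set x | forall i, S (d i * x)]].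

Definition every_extension_arithmetic (S : set nat) : Prop :=
  forall T : set nat, numerical_semigroup T -> extension S T ->
    arithmetic_extension S T.

(* Main.v *)
(* If S is not N, let F be its Frobenius number. Applying the hypothesis to the
   extension S + {F} shows that every gap x <> F has a proper multiple that is
   again a gap, so 2x <= F; together with the symmetry s in S -> F - s not in S
   this forces S = {0} + {x | x > F/2, x <> F}. Applied to the gaps F/2 and
   F/2 - 1 the same divisibility condition leaves only F = 1, 2, 3, 4, 6.
   Conversely, for these F an extension T <> S contains F, every gap x of T
   divides F, and multiplication by F/x maps T into S but x to F. *)
Require Import Defs.
From mathcomp Require Import all_boot.
From mathcomp Require Import boolp classical_sets functions cardinality.
From mathcomp Require Import zify.

Local Open Scope classical_set_scope.
Local Open Scope card_scope.

(* For [F = 0] this is all of nat. *)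
Definition upper_half (F : nat) : set nat :=
  [set x | x = 0 \/ (F < 2 * x /\ x <> F)].

Definition frobenius_values : seq nat := [:: 0; 1; 2; 3; 4; 6].

Lemma upper_half_submonoid F : submonoid (upper_half F).
Proof. by split=> [|x y]; rewrite /upper_half /=; lia. Qed.

Lemma upper_half_numerical F : numerical_semigroup (upper_half F).
Proof.
split; first exact: upper_half_submonoid.
apply: (@sub_finite_set _ _ `I_F.+1); last exact: finite_II.
by move=> x; rewrite /upper_half /=; lia.
Qed.

(** A positive [F] is the largest gap of [upper_half F], so testing the membership of [F] and [G] is
    enough. *)
Lemma upper_half_inj : injective upper_half.
Proof.
move=> F G eFG.
have := congr1 (fun A : set nat => A F) eFG.
have := congr1 (fun A : set nat => A G) eFG.
rewrite /upper_half /= => /propeqP eG /propeqP eF; lia.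
Qed.

(** One finite family serves all gaps: a multiplier that keeps a gap [x] of [T] outside [S]
    satisfies [d * x <= F], hence [d <= F]. *)
Lemma gapwise_arithmetic (S T : set nat) (F : nat) :
    S 0 -> (forall x, F < x -> S x) -> T 0 ->
    (forall x, ~ T x -> exists d, ~ S (d * x) /\ forall t, T t -> S (d * t)) ->
  arithmetic_extension S T.
Proof.
move=> S0 SF T0 gapT.
pose good d := 0 < d /\ forall t, T t -> S (d * t).
(* The default [F.+1] sends every positive number past [F], so it imposes no condition. *)
pose d (i : 'I_F.+1) := if `[< good i >] then nat_of_ord i else F.+1.
exists F.+1, d; split=> // [i|].
  by rewrite /d; case: asboolP => // -[].
apply/seteqP; split=> [t Tt i|x Sdx] /=.
  rewrite /d; case: asboolP => [[_ /(_ t Tt)]//|_].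
  by case: (posnP t) => [->|t0]; [rewrite muln0 | apply: SF; nia].
apply: contrapT => nTx; have [e [nSex Te]] := gapT _ nTx.
have x0 : 0 < x by case: posnP => // x0; rewrite x0 in nTx.
have exF : e * x <= F by rewrite leqNgt; apply/negP => /SF.
have e0 : 0 < e by case: posnP => // e0; move: nSex; rewrite e0 mul0n.
have eF : e < F.+1 by nia.
by apply: nSex; move: (Sdx (Ordinal eF)); rewrite /d; case: asboolP => // -[].
Qed.

Lemma upper_half_arithmetic (F : nat) :
  F \in frobenius_values -> every_extension_arithmetic (upper_half F).
Proof.
move=> Fv T [[T0 TD] _] ST; apply: (@gapwise_arithmetic _ _ F) => //.
- by left.
- by move=> x Fx; right; lia.
move=> x nTx; have x0 : x <> 0 by move=> x0; rewrite x0 in nTx.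
have [TF|nTF] := pselect (T F); last first.
  exists 1; rewrite mul1n; split=> [/ST//|t Tt]; rewrite mul1n.
  apply: contrapT => nSt; apply: nTF.
  have [tF|[t0 tF2]] : t = F \/ 0 < t /\ 2 * t <= F.
    by move: nSt; rewrite /upper_half /=; lia.
    by rewrite -tF.
  (* Here [F - t] either equals [t] or lies in the upper half, so [T] would contain [F]. *)
  have <- : t + (F - t) = F by lia.
  apply: TD => //; have [tF|tF] := eqVneq (2 * t) F.
    by have -> : F - t = t by lia.
  by apply: ST; right; lia.
have xF2 : 2 * x <= F.
  rewrite leqNgt; apply/negP => Fx; apply: nTx.
  by have [->//|xF] := eqVneq x F; apply: ST; right; lia.
have Fle : F <= 4 \/ F = 6 by move: Fv; rewrite !inE => /or4P[|||/or3P[]] /eqP->; lia.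
(* Only [x] = 1, 2, 3 remain, and 3 occurs only for [F = 6]. *)
have dx : F %/ x * x = F by case: x x0 xF2 {nTx} => [|[|[|[|x]]]]; case: Fle; lia.
(* As [x <= 3], a smaller [t] would be 1 and generate [x]. Multiplied by [F %/ x], the bound puts
   the image of [t] above F/2. *)
have half_notin t : T t -> 0 < t -> x < 2 * t.
  move=> Tt t0; rewrite ltnNge; apply/negP => tx; apply: nTx.
  have t1 : t = 1 by lia.
  by rewrite -[x]muln1 -t1; elim: x {x0 xF2 dx tx} => // n IH; rewrite mulSn; apply: TD.
exists (F %/ x); rewrite dx; split=> [[|[]]|t Tt]; try lia.
have [->|t0] := posnP t; first by left; rewrite muln0.
have := half_notin t Tt t0.
have tx : t <> x by move=> tx; rewrite tx in Tt.
rewrite -[F in upper_half F]dx; right; split; nia.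
Qed.

(** Some multiplier for the extension by [F] keeps [x] outside [S]; it is not 1, because it sends
    [F] into [S]. *)
Lemma arithmetic_gap_multiple (S : set nat) (F x : nat) :
    numerical_semigroup S -> every_extension_arithmetic S ->
    ~ S F -> (forall y, F < y -> S y) -> ~ S x -> x <> F ->
  exists2 d, 1 < d & ~ S (d * x).
Proof.
move=> [[S0 SD] Sfin] Sar nSF SF nSx xF.
have [||n [d [_ d0 eT]]] := Sar (S `|` [set F]).
- split; last by apply: sub_finite_set Sfin; apply: subsetC => y; left.
  split=> [|y z]; first by left.
  have FF : F + F = F \/ S (F + F).
    by case: (posnP F) => [->|F0]; [left | right; apply: SF; lia].
  have SDF y' : S y' -> S (y' + F) \/ y' + F = F.
    by case: (posnP y') => [->|y0]; [right | left; apply: SF; lia].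
  move=> [Sy|/= ->] [Sz|/= ->].
  + by left; apply: SD.
  + exact: SDF.
  + by rewrite addnC; apply: SDF.
  + by case: FF; [right | left].
- by move=> y; left.
have [i nSi] : exists i, ~ S (d i * x).
  apply: contrapT => /forallNP Sd.
  have : (S `|` [set F]) x by rewrite eT => i; apply: contrapT; apply: Sd.
  by case.
exists (d i) => //; rewrite ltn_neqAle d0 andbT; apply/eqP => di.
have : (S `|` [set F]) F by right.
by rewrite eT => /(_ i); rewrite -di mul1n.
Qed.

Lemma frobenius_number (S : set nat) :
    finite_set (~` S) -> S != setT ->
  exists2 F, ~ S F & forall x, F < x -> S x.
Proof.
move=> Sfin SnT.
have exg : exists x, `[< ~ S x >].
  apply: contrapT => /forallNP nS; case/eqP: SnT; apply/seteqP; split=> // x _.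
  by apply: contrapT => nSx; apply: (nS x); apply/asboolP.
have [m leSm] : exists m, forall x, `[< ~ S x >] -> x <= m.
  have [s es] := (finite_seqP _).1 Sfin.
  exists (\max_(y <- s) y) => x /asboolP nSx.
  by apply: (@leq_bigmax_seq _ s predT id) => //; have : (~` S) x by []; rewrite es.
case: (ex_maxnP exg leSm) => F /asboolP nSF maxF; exists F => // x Fx.
by apply: contrapT => nSx; have := maxF x (introT (asboolP _) nSx); lia.
Qed.

Lemma every_extension_arithmetic_upper_half (S : set nat) :
    numerical_semigroup S -> every_extension_arithmetic S ->
  exists2 F, F \in frobenius_values & S = upper_half F.
Proof.
move=> NS Sar; have [[S0 SD] Sfin] := NS.
have [->|SnT] := eqVneq S setT.
  by exists 0 => //; apply/seteqP; split=> // x _; rewrite /upper_half /=; lia.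
have [F nSF SF] := frobenius_number _ Sfin SnT.
have F0 : 0 < F by case: posnP => // F0; rewrite F0 in nSF.
have gapM x := arithmetic_gap_multiple S F x NS Sar nSF SF.
have gap_le x : ~ S x -> x <> F -> 2 * x <= F.
  move=> nSx /(gapM _ nSx) [d d1 nSdx].
  have : d * x <= F by rewrite leqNgt; apply/negP => /SF.
  nia.
have eS : S = upper_half F.
  apply/seteqP; split=> x.
    move=> Sx; have [->|x0] := posnP x; [by left | right].
    split; last by move=> xF; rewrite xF in Sx.
    rewrite ltnNge; apply/negP => xF.
    (* The gap [F - x] is at least F/2, so [gap_le] leaves only [2 * x = F], where it equals [x]. *)
    have SFx : ~ S (F - x) by move=> /(SD _ _ Sx); rewrite subnKC //; lia.
    have := gap_le _ SFx; have [tF|tF] := eqVneq (2 * x) F; last by lia.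
    by move=> _; apply: SFx; have -> : F - x = x by lia.
  move=> [->//|[Fx xF]]; apply: contrapT => /gap_le /(_ xF); lia.
exists F => //.
(* A proper multiple of [x] exceeds F/2, so the only gap it can be is [F] itself. *)
have dvd_gap x : 0 < x -> 2 * x <= F -> F < 4 * x -> F = 2 * x \/ F = 3 * x.
  move=> x0 xF Fx; have nSx : ~ S x by rewrite eS /upper_half /=; lia.
  have [|d d1] := gapM x nSx; first by lia.
  rewrite eS /upper_half /= => nSdx.
  have : d * x = F by nia.
  have : d < 4 by nia.
  by case: d d1 {nSdx} => [|[|[|[|]]]] //; lia.
rewrite !inE; case: (ltnP F 7) => F7.
  (* This rules out [F = 5]. *)
  have := dvd_gap 2; lia.
(* The first instance makes [F] even; the second then forces [F = 6]. *)
have := dvd_gap F./2; have := dvd_gap F./2.-1; lia.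
Qed.

Lemma sub_generated (A : set nat) : A `<=` generated A.
Proof. exact: sub_smallest. Qed.

Lemma generated_submonoid (A : set nat) : submonoid (generated A).
Proof.
split=> [M [[]] //|x y Ax Ay M MA].
by have [[_ MD] _] := MA; apply: MD; [exact: Ax | exact: Ay].
Qed.

(* Among the elements of [upper_half F] up to [F + a], for the five generating
   sets below, each one that is neither 0 nor a generator is the sum of its
   rounded halves, which are generators. *)
Lemma generated_upper_half (A : set nat) (F a : nat) :
    A `<=` upper_half F -> A a -> 0 < a ->
    (forall x, upper_half F x -> x <= F + a ->
       x = 0 \/ A x \/ A x./2 /\ A (x - x./2)) ->
  generated A = upper_half F.
Proof.
move=> AF Aa a0 small; have [gen0 genD] := generated_submonoid A.
apply/seteqP; split=> x.
  by apply; split=> //; exact: upper_half_submonoid.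
elim/ltn_ind: x => x IH Fx; case: (leqP x (F + a)) => xFa.
  have [->//|[Ax|[Ax1 Ax2]]] := small x Fx xFa; first exact: sub_generated.
  have -> : x = x./2 + (x - x./2) by lia.
  by apply: genD; apply: sub_generated.
have -> : x = a + (x - a) by lia.
by apply: genD; [exact: sub_generated | apply: IH; [lia | right; lia]].
Qed.

Theorem theorem8 :
  [set S : set nat | numerical_semigroup S /\ every_extension_arithmetic S] =
    [set [set: nat];
         generated [set 2; 3];
         generated [set 3; 4; 5];
         generated [set 2; 5];
         generated [set 3; 5; 7];
         generated [set 4; 5; 7]]
  /\ [set S : set nat | numerical_semigroup S /\ every_extension_arithmetic S]
       #= `I_6.
Proof.
have -> : [set S | numerical_semigroup S /\ every_extension_arithmetic S] =
    (upper_half \o nth 0 frobenius_values) @` `I_6.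
  apply/seteqP; split=> S /=.
    move=> [/every_extension_arithmetic_upper_half/[apply] -[F Fv ->]].
    by exists (index F frobenius_values); rewrite ?nth_index // index_mem.
  move=> [i i6 <-]; split; first exact: upper_half_numerical.
  exact/upper_half_arithmetic/mem_nth.
(* The count follows from the injectivity of [upper_half] and the distinctness of the six Frobenius
   values. *)
split; last first.
  apply: inj_card_eq => i j; rewrite !in_setE => i6 j6 /upper_half_inj /eqP.
  by rewrite nth_uniq // => /eqP.
have -> : [set: nat] = upper_half 0.
  by apply/seteqP; split=> // x _; rewrite /upper_half /=; lia.
have -> : generated [set 2; 3] = upper_half 1.
  by apply: (@generated_upper_half _ _ 2) => [x|||x]; rewrite /upper_half /=; lia.
have -> : generated [set 3; 4; 5] = upper_half 2.
  by apply: (@generated_upper_half _ _ 3) => [x|||x]; rewrite /upper_half /=; lia.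
have -> : generated [set 2; 5] = upper_half 3.
  by apply: (@generated_upper_half _ _ 2) => [x|||x]; rewrite /upper_half /=; lia.
have -> : generated [set 3; 5; 7] = upper_half 4.
  by apply: (@generated_upper_half _ _ 3) => [x|||x]; rewrite /upper_half /=; lia.
have -> : generated [set 4; 5; 7] = upper_half 6.
  by apply: (@generated_upper_half _ _ 4) => [x|||x]; rewrite /upper_half /=; lia.
apply/seteqP; split=> S /=.
  by move=> [[|[|[|[|[|[|//]]]]]] _ <-] /=; tauto.
case=> [[[[[]|]|]|]|] ->; [exists 0|exists 1|exists 2|exists 3|exists 4|exists 5] => //.
Qed.
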